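(* Let $(\mathfrak g,[\cdot,\cdot,\cdot]_{\mathfrak g})$ be a finite-dimensional real $3$-Lie algebra. Then $\mathfrak g$ has an abelian complex structure if and only if its complexification $\mathfrak g_{\mathbb C}$ admits a decomposition $\mathfrak g_{\mathbb C}=\mathfrak q\oplus\mathfrak p$ (direct sum of vector spaces), where $\mathfrak q$ and $\mathfrak p=\sigma(\mathfrak q)$ are complex abelian subalgebras of $\mathfrak g_{\mathbb C}$.
   Context: A $3$-Lie algebra is a vector space $\mathfrak g$ with a trilinear skew-symmetric bracket $[\cdot,\cdot,\cdot]_{\mathfrak g}$ satisfying $[x,y,[z,w,v]]=[[x,y,z],w,v]+[z,[x,y,w],v]+[z,w,[x,y,v]]$. A subalgebra is abelian if the bracket vanishes on it. The complexification $\mathfrak g_{\mathbb C}=\mathfrak g\otimes_{\mathbb R}\mathbb C=\{x+iy\mid x,y\in\mathfrak g\}$ is a complex $3$-Lie algebra with the complex-trilinear extension of the bracket; $\sigma(x+iy)=x-iy$ ($x,y\in\mathfrak g$) is the conjugation of $\mathfrak g_{\mathbb C}$ with respect to $\mathfrak g$. An almost complex structure on $\mathfrak g$ is a linear map $J:\mathfrak g\to\mathfrak g$ with $J^2=-\mathrm{Id}$. It is called an abelian complex structure if $[x,y,z]_{\mathfrak g}=[x,Jy,Jz]_{\mathfrak g}+[Jx,y,Jz]_{\mathfrak g}+[Jx,Jy,z]_{\mathfrak g}$ for all $x,y,z\in\mathfrak g$. *)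

(* Defs.v *)
From HB Require Import structures.
From mathcomp Require Import all_boot all_order all_algebra.
From mathcomp Require Import complex ring.
From mathcomp Require Import reals.

Set Implicit Arguments.
Unset Strict Implicit.
Unset Printing Implicit Defensive.

Import Order.TTheory GRing.Theory Num.Theory.
Local Open Scope ring_scope.

(* A finite-dimensional 3-Lie algebra over K.  Skew-symmetry is stated on the
   two adjacent transpositions, which generate the symmetric group S_3. *)
HB.mixin Record Vector_isThreeLie (K : numFieldType) (V : Type)
    of Vector K V := {
  br3 : V -> V -> V -> V;
  br3_linear1 : forall y z : V, linear (fun x => br3 x y z);
  br3_linear2 : forall x z : V, linear (fun y => br3 x y z);
  br3_linear3 : forall x y : V, linear (fun z => br3 x y z);
  br3_skew12 : forall x y z : V, br3 y x z = - br3 x y z;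
  br3_skew23 : forall x y z : V, br3 x z y = - br3 x y z;
  br3_fundamental : forall x y z w v : V,
    br3 x y (br3 z w v) =
      br3 (br3 x y z) w v + br3 z (br3 x y w) v + br3 z w (br3 x y v)
}.

#[short(type="threeLieType")]
HB.structure Definition ThreeLie (K : numFieldType) :=
  {V of Vector K V & Vector_isThreeLie K V}.

Lemma br3D1 (K : numFieldType) (g : threeLieType K) (x y u v : g) :
  br3 (u + v) x y = br3 u x y + br3 v x y.
Proof. by have := br3_linear1 x y 1 u v; rewrite /= !scale1r. Qed.

Lemma br3Z1 (K : numFieldType) (g : threeLieType K) (x y u : g) (a : K) :
  br3 (a *: u) x y = a *: br3 u x y.
Proof.
have br0 : br3 0 x y = 0.
  by apply: (addrI (br3 0 x y)); rewrite -br3D1 !addr0.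
by have := br3_linear1 x y a u 0; rewrite /= br0 !addr0.
Qed.

Lemma br3N1 (K : numFieldType) (g : threeLieType K) (x y u : g) :
  br3 (- u) x y = - br3 u x y.
Proof. by rewrite -scaleN1r br3Z1 scaleN1r. Qed.

Lemma br3D2 (K : numFieldType) (g : threeLieType K) (x y u v : g) :
  br3 x (u + v) y = br3 x u y + br3 x v y.
Proof. by have := br3_linear2 x y 1 u v; rewrite /= !scale1r. Qed.

Lemma br3Z2 (K : numFieldType) (g : threeLieType K) (x y u : g) (a : K) :
  br3 x (a *: u) y = a *: br3 x u y.
Proof.
have br0 : br3 x 0 y = 0.
  by apply: (addrI (br3 x 0 y)); rewrite -br3D2 !addr0.
by have := br3_linear2 x y a u 0; rewrite /= br0 !addr0.
Qed.

Lemma br3N2 (K : numFieldType) (g : threeLieType K) (x y u : g) :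
  br3 x (- u) y = - br3 x u y.
Proof. by rewrite -scaleN1r br3Z2 scaleN1r. Qed.

Lemma br3D3 (K : numFieldType) (g : threeLieType K) (x y u v : g) :
  br3 x y (u + v) = br3 x y u + br3 x y v.
Proof. by have := br3_linear3 x y 1 u v; rewrite /= !scale1r. Qed.

Lemma br3Z3 (K : numFieldType) (g : threeLieType K) (x y u : g) (a : K) :
  br3 x y (a *: u) = a *: br3 x y u.
Proof.
have br0 : br3 x y 0 = 0.
  by apply: (addrI (br3 x y 0)); rewrite -br3D3 !addr0.
by have := br3_linear3 x y a u 0; rewrite /= br0 !addr0.
Qed.

Lemma br3N3 (K : numFieldType) (g : threeLieType K) (x y u : g) :
  br3 x y (- u) = - br3 x y u.
Proof. by rewrite -scaleN1r br3Z3 scaleN1r. Qed.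

Definition br3E := (br3D1, br3D2, br3D3, br3N1, br3N2, br3N3, br3Z1, br3Z2, br3Z3).

Definition subalgebra (K : numFieldType) (g : threeLieType K)
    (U : {vspace g}) : Prop :=
  forall x y z : g, x \in U -> y \in U -> z \in U -> br3 x y z \in U.

Definition abelian_subalgebra (K : numFieldType) (g : threeLieType K)
    (U : {vspace g}) : Prop :=
  subalgebra U /\
  (forall x y z : g, x \in U -> y \in U -> z \in U -> br3 x y z = 0).

Definition almost_complex_structure (K : numFieldType) (g : threeLieType K)
    (J : 'End(g)) : Prop :=
  forall x : g, J (J x) = - x.

Definition abelian_complex_structure (K : numFieldType) (g : threeLieType K)
    (J : 'End(g)) : Prop :=
  almost_complex_structure J /\
  (forall x y z : g,
     br3 x y z = br3 x (J y) (J z) + br3 (J x) y (J z) + br3 (J x) (J y) z).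

(* The pair (x, y) stands for x + iy. *)
Definition complexification (R : realType) (V : vectType R) : Type :=
  (V * V)%type.

HB.instance Definition _ (R : realType) (V : vectType R) :=
  GRing.Zmodule.copy (complexification V) (V * V)%type.

(* (a + ib)(x + iy) = (ax - by) + i(ay + bx) *)
Definition cplx_scale (R : realType) (V : vectType R) (c : R[i])
    (u : complexification V) : complexification V :=
  (complex.Re c *: u.1 - complex.Im c *: u.2, complex.Re c *: u.2 + complex.Im c *: u.1).

Fact cplx_scaleA (R : realType) (V : vectType R) (a b : R[i])
    (u : complexification V) :
  cplx_scale a (cplx_scale b u) = cplx_scale (a * b) u.
Proof.
case: a b u => [a1 a2] [b1 b2] [x y]; rewrite /cplx_scale /=.
congr pair; rewrite !scalerDr ?scalerN !scalerBl ?scalerDl !scalerA ?opprD.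
  by rewrite (AC (2*2) ((1*4)*(2*3))).
by rewrite (AC (2*2) ((1*4)*(2*3))).
Qed.

Fact cplx_scale1 (R : realType) (V : vectType R) :
  left_id 1 (@cplx_scale R V).
Proof.
by case=> x y; rewrite /cplx_scale /= !scale1r !scale0r subr0 addr0.
Qed.

Fact cplx_scaleDr (R : realType) (V : vectType R) :
  right_distributive (@cplx_scale R V) +%R.
Proof.
move=> [a b] [x y] [z t]; rewrite /cplx_scale /=.
by congr pair; rewrite /= !scalerDr ?opprD addrACA.
Qed.

Fact cplx_scaleDl (R : realType) (V : vectType R) (u : complexification V) :
  {morph (@cplx_scale R V)^~ u : a b / a + b}.
Proof.
move: u => [x y] [a1 a2] [b1 b2]; rewrite /cplx_scale /=.
by congr pair; rewrite /= !scalerDl ?opprD addrACA.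
Qed.

HB.instance Definition _ (R : realType) (V : vectType R) :=
  GRing.Zmodule_isLmodule.Build R[i] (complexification V)
    (@cplx_scaleA R V) (@cplx_scale1 R V) (@cplx_scaleDr R V)
    (@cplx_scaleDl R V).

Fact cplx_vect_axiom (R : realType) (V : vectType R) :
  Vector.axiom (\dim {:V}) (complexification V).
Proof.
set e := vbasis {:V}.
have freee : free e := basis_free (vbasisP {:V}).
exists (fun u : complexification V =>
  \row_j Complex (coord e j u.1) (coord e j u.2)).
  move=> [a b] [x y] [z t]; apply/rowP=> j; rewrite !mxE /=.
  rewrite !linearD linearN !linearZ /=.
  by [].
exists (fun r : 'rV[R[i]]_(\dim {:V}) =>
  (\sum_j complex.Re (r 0 j) *: e`_j, \sum_j complex.Im (r 0 j) *: e`_j)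
    : complexification V).
  move=> [x y]; congr pair; rewrite [RHS](coord_vbasis (memvf _));
  by apply: eq_bigr => j _; rewrite mxE.
by move=> r; apply/rowP=> j; rewrite !mxE /= !coord_sum_free //; case: (r 0 j).
Qed.

HB.instance Definition _ (R : realType) (V : vectType R) :=
  Lmodule_hasFinDim.Build R[i] (complexification V) (cplx_vect_axiom V).

Definition cplx_embed (R : realType) (V : vectType R) (x : V) :
    complexification V :=
  (x, 0).

Definition cplx_conj (R : realType) (V : vectType R)
    (u : complexification V) : complexification V :=
  (u.1, - u.2).

Lemma cplx_decomp (R : realType) (V : vectType R) (u : complexification V) :
  u = cplx_embed u.1 + (Complex 0 1 : R[i]) *: cplx_embed u.2.
Proof.
case: u => x y; congr pair => /=.
  by rewrite scale0r scaler0 subr0 addr0.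
by rewrite scaler0 scale1r !add0r.
Qed.

(* Expansion of [x1 + iy1, x2 + iy2, x3 + iy3] by complex trilinearity. *)
Definition cplx_br3 (R : realType) (g : threeLieType R)
    (u v w : complexification g) : complexification g :=
  (br3 u.1 v.1 w.1 - br3 u.1 v.2 w.2 - br3 u.2 v.1 w.2 - br3 u.2 v.2 w.1,
   br3 u.2 v.1 w.1 + br3 u.1 v.2 w.1 + br3 u.1 v.1 w.2 - br3 u.2 v.2 w.2).

Lemma coord_eq (K : fieldType) (V : vectType K) (u v : V) :
  (forall i, coord (vbasis {:V}) i u = coord (vbasis {:V}) i v) -> u = v.
Proof.
move=> uv; rewrite (coord_vbasis (memvf u)) (coord_vbasis (memvf v)).
by apply: eq_bigr => i _; rewrite uv.
Qed.

Fact cplx_br3_linear1 (R : realType) (g : threeLieType R)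
    (v w : complexification g) :
  linear (fun u => cplx_br3 u v w).
Proof.
case: v w => [x y] [z t] [a b] [x1 y1] [x2 y2]; rewrite /cplx_br3.
by congr pair; apply: coord_eq => i; rewrite /= !br3E; ring.
Qed.

Fact cplx_br3_linear2 (R : realType) (g : threeLieType R)
    (u w : complexification g) :
  linear (fun v => cplx_br3 u v w).
Proof.
case: u w => [x y] [z t] [a b] [x1 y1] [x2 y2]; rewrite /cplx_br3.
by congr pair; apply: coord_eq => i; rewrite /= !br3E; ring.
Qed.

Fact cplx_br3_linear3 (R : realType) (g : threeLieType R)
    (u v : complexification g) :
  linear (fun w => cplx_br3 u v w).
Proof.
case: u v => [x y] [z t] [a b] [x1 y1] [x2 y2]; rewrite /cplx_br3.
by congr pair; apply: coord_eq => i; rewrite /= !br3E; ring.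
Qed.

Fact cplx_br3_skew12 (R : realType) (g : threeLieType R)
    (u v w : complexification g) :
  cplx_br3 v u w = - cplx_br3 u v w.
Proof.
congr pair; apply: coord_eq => i;
by rewrite /= !(br3_skew12 u.1 v.1, br3_skew12 u.2 v.1,
  br3_skew12 u.1 v.2, br3_skew12 u.2 v.2); ring.
Qed.

Fact cplx_br3_skew23 (R : realType) (g : threeLieType R)
    (u v w : complexification g) :
  cplx_br3 u w v = - cplx_br3 u v w.
Proof.
congr pair; apply: coord_eq => i;
by rewrite /= !(br3_skew23 _ v.1 w.1, br3_skew23 _ v.1 w.2,
  br3_skew23 _ v.2 w.1, br3_skew23 _ v.2 w.2); ring.
Qed.

Fact cplx_br3_fundamental (R : realType) (g : threeLieType R)
    (a b c d e : complexification g) :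
  cplx_br3 a b (cplx_br3 c d e) =
    cplx_br3 (cplx_br3 a b c) d e + cplx_br3 c (cplx_br3 a b d) e
      + cplx_br3 c d (cplx_br3 a b e).
Proof.
congr pair; apply: coord_eq => i;
by rewrite /= !br3E ![br3 _ _ (br3 c.1 _ _)]br3_fundamental
  ![br3 _ _ (br3 c.2 _ _)]br3_fundamental; ring.
Qed.

HB.instance Definition _ (R : realType) (g : threeLieType R) :=
  Vector_isThreeLie.Build R[i] (complexification g)
    (@cplx_br3_linear1 R g) (@cplx_br3_linear2 R g) (@cplx_br3_linear3 R g)
    (@cplx_br3_skew12 R g) (@cplx_br3_skew23 R g)
    (@cplx_br3_fundamental R g).

Lemma cplx_br3_embed (R : realType) (g : threeLieType R) (x y z : g) :
  br3 (cplx_embed x) (cplx_embed y) (cplx_embed z) = cplx_embed (br3 x y z).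
Proof.
have br01 (u v : g) : br3 0 u v = 0 by have:= br3Z1 u v 0 0; rewrite !scale0r.
have br02 (u v : g) : br3 u 0 v = 0 by have:= br3Z2 u v 0 0; rewrite !scale0r.
have br03 (u v : g) : br3 u v 0 = 0 by have:= br3Z3 u v 0 0; rewrite !scale0r.
by congr pair; rewrite /= !(br01, br02, br03) ?subr0 ?addr0.
Qed.

(* Main.v *)
Require Import Defs.
From HB Require Import structures.
From mathcomp Require Import all_boot all_order all_algebra.
From mathcomp Require Import complex reals.
Set Implicit Arguments.
Unset Strict Implicit.
Unset Printing Implicit Defensive.
Import Order.TTheory GRing.Theory Num.Theory.
Local Open Scope ring_scope.

(** An almost complex structure J on g is the same thing as a complex subspace q
    of the complexification with g_C = q (+) sigma(q): the subspace is the
    i-eigenspace of the complexified J, which is the graph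
    q = { x - i J x | x in g }, and sigma(q) is the (-i)-eigenspace.
    Conversely, when q and sigma(q) are complementary, every real x is uniquely
    a + b with a in q and b in sigma(q); invariance of x under sigma forces
    b = sigma(a), so x = 2 Re a and q is the graph of x |-> - J x for a real
    linear J.  Stability of the graph under multiplication by i is exactly
    J^2 = - Id.

    Under this dictionary the two conditions on brackets agree.  Write r(x,y,z)
    for [x,y,z] - [x,Jy,Jz] - [Jx,y,Jz] - [Jx,Jy,z], the obstruction to J being
    abelian.  Expanding by trilinearity and using J^2 = - Id gives
      [x - iJx, y - iJy, z - iJz] = r(x,y,z) + i r(Jx,Jy,Jz),
    so the bracket vanishes on q if and only if r vanishes identically.  As
    sigma is compatible with brackets, it then vanishes on sigma(q) as well. *)

(** * Conjugation *)

Lemma cplx_conjK (R : realType) (V : vectType R) :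
  involutive (@cplx_conj R V).
Proof. by case=> x y; rewrite /cplx_conj /= opprK. Qed.

Lemma cplx_conj_br3 (R : realType) (g : threeLieType R)
    (u v w : complexification g) :
  br3 (cplx_conj u) (cplx_conj v) (cplx_conj w) = cplx_conj (br3 u v w).
Proof.
congr pair; rewrite /= !br3E ?opprK //.
by rewrite !opprD !opprK.
Qed.

Lemma abelian_subalgebra_conj (R : realType) (g : threeLieType R)
    (q p : {vspace complexification g})
    (p_conj : forall v, v \in p <-> exists2 u, u \in q & v = cplx_conj u) :
  abelian_subalgebra q -> abelian_subalgebra p.
Proof.
move=> [_ q0].
have p0 u v w : u \in p -> v \in p -> w \in p -> br3 u v w = 0.
  move=> /p_conj[a qa ->] /p_conj[b qb ->] /p_conj[c qc ->].
  by rewrite cplx_conj_br3 q0 // /cplx_conj oppr0.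
by split=> // u v w hu hv hw; rewrite p0 ?mem0v.
Qed.

Lemma scale_imaginary (R : realType) (V : vectType R) (x y : V) :
  (Complex 0 1 : R[i]) *: ((x, y) : complexification V) = (- y, x).
Proof. by congr pair; rewrite /= !scale0r scale1r !add0r. Qed.

Lemma scale_real (R : realType) (V : vectType R) (a : R) (x y : V) :
  (Complex a 0 : R[i]) *: ((x, y) : complexification V) = (a *: x, a *: y).
Proof. by congr pair; rewrite /= scale0r ?subr0 ?addr0. Qed.

(** * The graph of an almost complex structure *)

Definition in_graph (R : realType) (V : vectType R) (J : 'End(V))
    (u : complexification V) : Prop :=
  u.2 = - J u.1.

Definition abelian_defect (R : realType) (g : threeLieType R) (J : 'End(g))
    (x y z : g) : g :=
  br3 x y z - br3 x (J y) (J z) - br3 (J x) y (J z) - br3 (J x) (J y) z.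

Lemma abelian_defect_eq0 (R : realType) (g : threeLieType R) (J : 'End(g))
    (x y z : g) :
  abelian_defect J x y z = 0 <->
  br3 x y z = br3 x (J y) (J z) + br3 (J x) y (J z) + br3 (J x) (J y) z.
Proof.
rewrite /abelian_defect -!addrA -!opprD !addrA.
by split=> [/subr0_eq|->]; rewrite ?subrr.
Qed.

(** The imaginary part is again a defect, evaluated at (Jx, Jy, Jz): applying
    J twice to two of the arguments gives two signs, which cancel. *)
Lemma br3_graph (R : realType) (g : threeLieType R) (J : 'End(g))
    (J2 : almost_complex_structure J) (u v w : complexification g)
    (hu : in_graph J u) (hv : in_graph J v) (hw : in_graph J w) :
  br3 u v w = (abelian_defect J u.1 v.1 w.1,
               abelian_defect J (J u.1) (J v.1) (J w.1)).
Proof.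
rewrite /br3 /= /cplx_br3 hu hv hw /abelian_defect !J2 !br3E !opprK.
congr pair.
by rewrite -[RHS]addrA -[RHS]addrA [RHS]addrC; congr (_ + _); rewrite !addrA.
Qed.

(** The graph contains (x, - Jx) for every real x, so no information is lost in
    passing from the bracket of three vectors of q to the defect. *)
Lemma abelian_graphP (R : realType) (g : threeLieType R) (J : 'End(g))
    (J2 : almost_complex_structure J) (q : {vspace complexification g})
    (qJ : forall u, u \in q <-> in_graph J u) :
  abelian_subalgebra q <-> abelian_complex_structure J.
Proof.
split=> [[_ q0]|[_ abJ]].
  split=> // x y z; apply/abelian_defect_eq0.
  have inq t : ((t, - J t) : complexification g) \in q by exact/qJ.
  have := q0 _ _ _ (inq x) (inq y) (inq z).
  by rewrite (br3_graph J2) //= => -[].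
have q0 u v w : u \in q -> v \in q -> w \in q -> br3 u v w = 0.
  move=> /qJ hu /qJ hv /qJ hw; rewrite (br3_graph J2) //.
  by congr pair; apply/abelian_defect_eq0.
by split=> // u v w hu hv hw; rewrite q0 ?mem0v.
Qed.

(** * From a complex structure to a decomposition *)

Definition cplx_map (R : realType) (V : vectType R) (J : 'End(V))
    (u : complexification V) : complexification V :=
  (J u.1, J u.2).

Fact cplx_map_linear (R : realType) (V : vectType R) (J : 'End(V)) :
  linear (cplx_map J).
Proof.
move=> [a b] [x y] [z t]; rewrite /cplx_map /=.
by congr pair; rewrite /= !linearD ?linearN !linearZ.
Qed.

HB.instance Definition _ (R : realType) (V : vectType R) (J : 'End(V)) :=
  GRing.isLinear.Build R[i] (complexification V) (complexification V) *:%R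
    (cplx_map J) (cplx_map_linear J).

Definition eigen_i (R : realType) (V : vectType R) (J : 'End(V)) :
    {vspace complexification V} :=
  passmx.leigenspace (linfun (cplx_map J)) (Complex 0 1 : R[i]).

(** Comparing real parts in J(x + iy) = i(x + iy) gives Jx = - y; the imaginary
    parts Jy = x then agree by J^2 = - Id. *)
Lemma mem_eigen_i (R : realType) (V : vectType R) (J : 'End(V))
    (J2 : forall x, J (J x) = - x) (u : complexification V) :
  u \in eigen_i J <-> in_graph J u.
Proof.
rewrite /eigen_i /passmx.leigenspace memv_ker.
rewrite add_lfunE opp_lfunE scale_lfunE id_lfunE lfunE subr_eq0 /=.
case: u => x y; rewrite scale_imaginary /cplx_map /in_graph /=.
split=> [/eqP[-> _]|->]; first by rewrite opprK.
by rewrite linearN /= J2 !opprK.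
Qed.

Lemma almost_complexN (R : realType) (V : vectType R) (J : 'End(V)) :
  (forall x, J (J x) = - x) -> forall x, (- J)%R ((- J)%R x) = - x.
Proof. by move=> J2 x; rewrite !opp_lfunE linearN /= J2 opprK. Qed.

Lemma in_graph_conj (R : realType) (V : vectType R) (J : 'End(V))
    (u : complexification V) :
  in_graph (- J) (cplx_conj u) <-> in_graph J u.
Proof.
rewrite /in_graph /= opp_lfunE opprK.
by split=> [<-|->]; rewrite opprK.
Qed.

Lemma vect_opp_fix_eq0 (K : numFieldType) (V : lmodType K) (x : V) :
  x = - x -> x = 0.
Proof.
move/eqP; rewrite -addr_eq0 -mulr2n -scaler_nat scaler_eq0 pnatr_eq0 /=.
exact: eqP.
Qed.

(** The vectors of the two eigenspaces are (x, - Jx) and (x, Jx); being in both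
    forces Jx = - Jx. *)
Lemma eigen_i_capN (R : realType) (V : vectType R) (J : 'End(V))
    (J2 : forall x, J (J x) = - x) :
  (eigen_i J :&: eigen_i (- J) = 0)%VS.
Proof.
apply/eqP; rewrite -subv0; apply/subvP=> -[x y]; rewrite memv_cap memv0.
case/andP=> /(mem_eigen_i J2) + /(mem_eigen_i (almost_complexN J2)).
rewrite /in_graph /= opp_lfunE opprK => yNJ yJ.
have y0 : y = 0 by apply: vect_opp_fix_eq0; rewrite {1}yNJ yJ.
have x0 : x = 0 by apply: oppr_inj; rewrite -J2 -yJ y0 linear0 oppr0.
by rewrite x0 y0.
Qed.

(** The projections onto the two eigenspaces are the usual
    (u - i J u) / 2 and (u + i J u) / 2; below w and z are their doubles. *)
Lemma eigen_i_addN (R : realType) (V : vectType R) (J : 'End(V))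
    (J2 : forall x, J (J x) = - x) :
  (eigen_i J + eigen_i (- J) = fullv)%VS.
Proof.
apply/eqP; rewrite eqEsubv subvf; apply/subvP=> -[x y] _.
pose w : complexification V := (x + J y, - J (x + J y)).
have wJ : w \in eigen_i J by exact/(mem_eigen_i J2).
pose z : complexification V := (x - J y, J (x - J y)).
have zJ : z \in eigen_i (- J).
  by apply/(mem_eigen_i (almost_complexN J2)); rewrite /in_graph opp_lfunE opprK.
have -> : ((x, y) : complexification V) = (Complex 2^-1 0 : R[i]) *: (w + z).
  have half (t : V) : t = 2^-1 *: (t + t).
    by rewrite -mulr2n -scaler_nat scalerA mulVf ?pnatr_eq0 ?scale1r.
  have -> : w + z = ((x + x, y + y) : complexification V).
    congr pair => /=; first by rewrite addrACA subrr addr0.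
    have -> : J (x - J y) = J x + y by rewrite linearB /= J2 opprK.
    have -> : J (x + J y) = J x - y by rewrite linearD /= J2.
    by rewrite opprB [J x + y]addrC addrACA addNr addr0.
  by rewrite scale_real; congr pair; exact: half.
exact: memvZ (memv_add wJ zJ).
Qed.

(** Conjugating the graph of - J gives the graph of J, which is why the
    conjugate of the i-eigenspace of J can be presented as the i-eigenspace of
    - J, itself an almost complex structure. *)
Lemma conj_eigen_iP (R : realType) (V : vectType R) (J : 'End(V))
    (J2 : forall x, J (J x) = - x) (v : complexification V) :
  v \in eigen_i (- J) <-> exists2 u, u \in eigen_i J & v = cplx_conj u.
Proof.
apply: (iff_trans (mem_eigen_i (almost_complexN J2) v)).
split=> [hv|[u /(mem_eigen_i J2) hu ->]]; last exact/in_graph_conj.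
exists (cplx_conj v); last by rewrite cplx_conjK.
by apply/(mem_eigen_i J2)/in_graph_conj; rewrite cplx_conjK.
Qed.

(** * From a decomposition to a complex structure *)

Section DecompositionGraph.

Variables (R : realType) (V : vectType R) (q p : {vspace complexification V}).
Hypothesis qp_full : (q + p = fullv)%VS.
Hypothesis qp_cap : (q :&: p = 0)%VS.
Hypothesis p_conj : forall v : complexification V,
  v \in p <-> exists2 u : complexification V, u \in q & v = cplx_conj u.

(** A vector of q fixed by conjugation is its own conjugate in p, hence lies in
    the trivial intersection. *)
Lemma conj_fixed_eq0 (u : complexification V) :
  u \in q -> cplx_conj u = u -> u = 0.
Proof.
move=> uq uc; apply/eqP; rewrite -memv0 -qp_cap memv_cap uq.
by apply/p_conj; exists u.
Qed.

(** The difference of two candidates is the purely imaginary vector i(y - z);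
    multiplied by i it becomes real, and a real vector of q vanishes. *)
Lemma graph_unique (x y z : V) :
  ((x, y) : complexification V) \in q -> ((x, z) : complexification V) \in q ->
  y = z.
Proof.
move=> xy xz; apply/eqP; rewrite -subr_eq0 -oppr_eq0; apply/eqP.
suff : ((- (y - z), 0) : complexification V) = 0 by case.
apply: conj_fixed_eq0; last by rewrite /cplx_conj /= oppr0.
rewrite -(scale_imaginary 0 (y - z)) memvZ //.
by have := memvB xy xz; rewrite -[_ - _]/((x - x, y - z)) subrr.
Qed.

(** With x = a + b, a in q and b in p, the vector 2a = (x, - Jx) has real part x;
    this reads J off its imaginary part. *)
Definition graph_fun (x : V) : V :=
  - (2 *: (daddv_pi q p (cplx_embed x)).2).

Fact graph_fun_linear : linear graph_fun.
Proof.
move=> a x y; rewrite /graph_fun.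
have -> : cplx_embed (a *: x + y)
    = (Complex a 0 : R[i]) *: cplx_embed x + cplx_embed y.
  by rewrite scale_real scaler0; congr pair; rewrite /= addr0.
rewrite (linearD (daddv_pi q p)) (linearZ_LR (daddv_pi q p)) /=.
by rewrite scale0r addr0 scalerDr opprD scalerN !scalerA mulrC.
Qed.

HB.instance Definition _ :=
  GRing.isLinear.Build R V V *:%R graph_fun graph_fun_linear.

(** Writing x = a + sigma(b) with a, b in q, the imaginary parts of a and b
    agree since x is real, so a - b is a real vector of q. Hence a = b and
    2a has real part x. *)
Lemma mem_graph_fun (x : V) : ((x, - graph_fun x) : complexification V) \in q.
Proof.
rewrite /graph_fun opprK; set a := daddv_pi q p _.
have aq : a \in q by exact: memv_pi.
have : a + daddv_pi p q (cplx_embed x) = cplx_embed x.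
  by rewrite daddv_pi_add // qp_full memvf.
have /p_conj[b bq ->] := memv_pi p q (cplx_embed x).
move: a b aq bq => [a1 a2] [b1 b2] aq bq [/= ab1 /subr0_eq ab2].
move: ab2 ab1 aq bq => -> <- aq bq.
have /eqP : ((a1 - b1, 0) : complexification V) = 0.
  apply: conj_fixed_eq0; last by rewrite /cplx_conj /= oppr0.
  by have := memvB aq bq; rewrite -[_ - _]/((a1 - b1, b2 - b2)) subrr.
rewrite -[_ == _]/((_ == 0) && _) subr_eq0 => /andP[/eqP ab _].
rewrite scaler_nat mulr2n -ab.
exact: (memvD aq aq).
Qed.

(** Multiplying (x, - Jx) by i yields (Jx, x), again in q; comparing it with
    (Jx, - J(Jx)) gives J^2 = - Id. *)
Lemma decomposition_graph :
  exists2 J : 'End(V), (forall x, J (J x) = - x) &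
    forall u, u \in q <-> in_graph J u.
Proof.
exists (linfun graph_fun) => [x|[x y]].
  have := memvZ (Complex 0 1 : R[i]) (mem_graph_fun x).
  rewrite scale_imaginary opprK => /(graph_unique (mem_graph_fun _)) JJx.
  by apply: oppr_inj; rewrite !lfunE /= JJx opprK.
rewrite /in_graph lfunE /=; split=> [xy|->]; last exact: mem_graph_fun.
exact: graph_unique xy (mem_graph_fun x).
Qed.

End DecompositionGraph.

Theorem corollary6p13 (R : realType) (g : threeLieType R) :
  (exists J : 'End(g), abelian_complex_structure J) <->
  (exists q p : {vspace complexification g},
    [/\ (q + p = fullv)%VS,
        (q :&: p = 0)%VS,
        forall v : complexification g,
          v \in p <-> (exists2 u : complexification g, u \in q & v = cplx_conj u),
        abelian_subalgebra q &
        abelian_subalgebra p]).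
Proof.
split=> [[J abJ]|[q [p [qp_full qp_cap p_conj abq _]]]].
  have J2 : forall x, J (J x) = - x := abJ.1.
  have abq : abelian_subalgebra (eigen_i J).
    exact/(abelian_graphP J2 (mem_eigen_i J2)).
  exists (eigen_i J), (eigen_i (- J)); split.
  - exact: eigen_i_addN J2.
  - exact: eigen_i_capN J2.
  - exact: conj_eigen_iP J2.
  - exact: abq.
  exact: abelian_subalgebra_conj (conj_eigen_iP J2) abq.
have [J J2 qJ] := decomposition_graph qp_full qp_cap p_conj.
by exists J; apply/(abelian_graphP J2 qJ).
Qed.
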